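(* Let $A\in \mathrm{SL}_2(\mathbb{Z})$ be a matrix with trace $>2$, let $\lambda$ be the eigenvalue of $A$ with $\lambda>1$, and let $p=\log\lambda$. Then the group $\mathbb{Z}^2\rtimes_A\mathbb{Z}$ embeds isomorphically into $\mathcal{S}(p,p)$ as a discrete, co-compact subgroup. Thus, the group $\mathbb{Z}^2\rtimes_A\mathbb{Z}$ acts on $\mathsf{Sol}(p,p)$ with compact quotient.
   Context: The group $\mathbb{Z}^2\rtimes_A\mathbb{Z}$ is the semi-direct product in which $m\in\mathbb{Z}$ acts on $\mathbb{Z}^2$ by $v\mapsto A^m v$ (column vectors); equivalently, it is the group of all $3\times3$ block matrices $\begin{pmatrix} A^m & v\\ 0 & 1\end{pmatrix}$ with $m\in\mathbb{Z}$, $v\in\mathbb{Z}^2$. For real $p,q>0$, $\mathsf{Sol}(p,q)$ is the manifold $\mathbb{R}^3$ with coordinates $(x,y,z)$ and Riemannian length element $$ds^2=e^{-2pz}\,dx^2+e^{2qz}\,dy^2+dz^2 .$$ $\mathcal{S}(p,q)$ is the Lie group $$\mathcal{S}(p,q)=\left\{\begin{pmatrix} e^{pc}&a&0\\ 0&1&0\\ 0&b&e^{-qc}\end{pmatrix}:\ a,b,c\in\mathbb{R}\right\}$$ under matrix multiplication. Identifying the displayed matrix with $(a,b,c)$, it acts on $\mathsf{Sol}(p,q)$ by isometries via $$(a,b,c)\cdot(x,y,z)=\bigl(e^{pc}x+a,\ e^{-qc}y+b,\ c+z\bigr).$$ A discrete subgroup is co-compact if the quotient of the group by it is compact. The action of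 $\mathbb{Z}^2\rtimes_A\mathbb{Z}$ on $\mathsf{Sol}(p,p)$ is the one obtained by restricting the action of $\mathcal{S}(p,p)$ to the embedded copy of the group. *)

(* Defs.v *)
From HB Require Import structures.
From mathcomp Require Import all_boot all_order all_algebra.
From mathcomp Require Import all_classical all_reals all_analysis.
Import Order.TTheory GRing.Theory Num.Theory.
Import numFieldNormedType.Exports.

Set Implicit Arguments.
Unset Strict Implicit.
Unset Printing Implicit Defensive.

Local Open Scope classical_set_scope.
Local Open Scope ring_scope.
Local Open Scope quotient_scope.

(* The pair (v, m) stands for the block matrix [A^m v; 0 1]. *)
Definition semidirect (A : 'M[int]_2) (_ : \det A = 1) : Type :=
  ('cV[int]_2 * int)%type.

Section Semidirect.
Variables (A : 'M[int]_2) (detA : \det A = 1).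
Local Notation G := (semidirect detA).

HB.instance Definition _ := Choice.copy G ('cV[int]_2 * int)%type.

Definition semidirect_one : G := (0, 0).

Definition semidirect_mul (g h : G) : G :=
  (A ^ g.2 *m h.1 + g.1, g.2 + h.2).

Definition semidirect_inv (g : G) : G := (- (A ^ (- g.2) *m g.1), - g.2).

Lemma semidirect_unit : A \is a GRing.unit.
Proof. by rewrite -[_ \is a _]/(A \in unitmx) unitmxE detA. Qed.

Lemma semidirect_mulA : associative semidirect_mul.
Proof.
move=> g h k; congr pair; last exact: addrA.
by rewrite /= exprzDr ?semidirect_unit// mulmxDr addrA mulmxA.
Qed.

Lemma semidirect_mul1 : left_id semidirect_one semidirect_mul.
Proof.
by case=> v m; congr pair; rewrite /= ?expr0z ?add0r// mul1mx addr0.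
Qed.

Lemma semidirect_mulr1 : right_id semidirect_one semidirect_mul.
Proof. by case=> v m; congr pair; rewrite /= ?addr0// mulmx0 add0r. Qed.

Lemma semidirect_mulV :
  left_inverse semidirect_one semidirect_inv semidirect_mul.
Proof. by case=> v m; congr pair; rewrite /= ?addNr// subrr. Qed.

Lemma semidirect_mulrV :
  right_inverse semidirect_one semidirect_inv semidirect_mul.
Proof.
case=> v m; congr pair; rewrite /= ?subrr// mulmxN mulmxA.
rewrite -[A ^ m *m _]/(A ^ m * A ^ (- m)) -exprzDr ?semidirect_unit// subrr expr0z.
by rewrite mul1mx addNr.
Qed.

HB.instance Definition _ := isGroup.Build G semidirect_mulA semidirect_mul1
  semidirect_mulr1 semidirect_mulV semidirect_mulrV.
End Semidirect.

Section QuotientByEquivalence.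
Variables (X : choiceType) (r : X -> X -> Prop).
Hypotheses (r_refl : forall x, r x x) (r_sym : forall x y, r x y -> r y x)
  (r_trans : forall x y z, r x y -> r y z -> r x z).

Definition asbool_rel : rel X := fun x y => `[< r x y >].

Lemma asbool_rel_equiv : equiv_class_of asbool_rel.
Proof.
split=> [x|x y|y x z].
- exact/asboolP.
- by apply/asboolP/asboolP; exact: r_sym.
- by move=> /asboolP xy /asboolP yz; apply/asboolP; exact: r_trans xy yz.
Qed.
End QuotientByEquivalence.

Section Cosets.
Variables (G : groupType) (H : groupClosed G).

Definition lcoset_rel (x y : G) : Prop := (x^-1 * y)%g \in H.

Lemma lcoset_equiv : equiv_class_of (asbool_rel lcoset_rel).
Proof.
apply: asbool_rel_equiv => [x|x y|x y z]; rewrite /lcoset_rel.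
- by rewrite mulVg; exact: gpred1.
- by move=> xy; rewrite -[x in X in X \in _]invgK -invgM gpredV.
- by move=> xy yz; rewrite -[z](mulVKg y) mulgA; exact: gpredM.
Qed.

(* G / H, the set of the left cosets x H. *)
Definition lcosets_quot := {eq_quot (EquivRelPack lcoset_equiv)}.
End Cosets.

Section ImageSubgroup.
Variables (G H : groupType) (phi : UMagmaMorphism.type G H).

Definition image_pred : {pred H} := [pred x | `[< range phi x >]].

Lemma image_predM : mulg_closed image_pred.
Proof.
move=> _ _ /asboolP[g _ <-] /asboolP[h _ <-]; apply/asboolP.
by exists (g * h)%g => //; rewrite gmulfM.
Qed.

Lemma image_pred1 : 1%g \in image_pred.
Proof. by apply/asboolP; exists 1%g => //; rewrite gmulf1. Qed.

Lemma image_predV : invg_closed image_pred.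
Proof.
move=> _ /asboolP[g _ <-]; apply/asboolP.
by exists (g^-1)%g => //; rewrite gmulfV.
Qed.

HB.instance Definition _ := isMulClosed.Build H image_pred image_predM.
HB.instance Definition _ := isMul1Closed.Build H image_pred image_pred1.
HB.instance Definition _ := isInvClosed.Build H image_pred image_predV.

Definition image_group : groupClosed H := image_pred.
End ImageSubgroup.

Record group_action (G : groupType) (X : Type) := GroupAction {
  act :> G -> X -> X;
  act1 : forall x, act 1%g x = x;
  actM : forall g h x, act (g * h)%g x = act g (act h x) }.

Definition restrict_action (G H : groupType) (X : Type)
    (a : group_action H X) (phi : UMagmaMorphism.type G H) :
  group_action G X.
Proof.
apply: (@GroupAction G X (fun g x => a (phi g) x)) => [x|g h x].
  by rewrite gmulf1 act1.
by rewrite gmulfM actM.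
Defined.

Section Orbits.
Variables (G : groupType) (X : choiceType) (a : group_action G X).

Definition orbit_rel (x y : X) : Prop := exists g, a g x = y.

Lemma orbit_equiv : equiv_class_of (asbool_rel orbit_rel).
Proof.
apply: asbool_rel_equiv => [x|x _ [g <-]|x _ _ [g <-] [h <-]].
- by exists 1%g; rewrite act1.
- by exists (g^-1)%g; rewrite -actM mulVg act1.
- by exists (h * g)%g; rewrite actM.
Qed.

Definition orbit_quot := {eq_quot (EquivRelPack orbit_equiv)}.
End Orbits.

Definition discrete_subset (X : topologicalType) (B : set X) : Prop :=
  isolated B = B.

Section SolGroup.
Variables (R : realType) (p q : {posnum R}).

Definition sol_mx (a b c : R) : 'M[R]_3 :=
  \matrix_(i < 3, j < 3)
    (nth [::] [:: [:: expR (p%:num * c); a; 0];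
                  [:: 0; 1; 0];
                  [:: 0; b; expR (- (q%:num * c))]] i)`_j.

Definition sol_set : set 'M[R]_3 :=
  [set M | exists a b c, M = sol_mx a b c].

Definition sol_group : Type := set_type sol_set.

(* [Topological] is the subspace topology inherited from 'M[R]_3. *)
HB.instance Definition _ := Choice.copy sol_group (set_type sol_set).
HB.instance Definition _ := Topological.copy sol_group (set_type sol_set).

Lemma sol_mxM a b c a' b' c' :
  sol_mx a b c *m sol_mx a' b' c' =
  sol_mx (expR (p%:num * c) * a' + a) (expR (- (q%:num * c)) * b' + b) (c + c').
Proof.
apply/matrixP => i j; rewrite !mxE !big_ord_recl big_ord0 !mxE /=.
case: i => -[|[|[|//]]] i3; case: j => -[|[|[|//]]] j3 /=;
  rewrite ?(mulr0, mul0r, mulr1, mul1r, addr0, add0r) //.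
- by rewrite mulrDr expRD.
- by rewrite addrC.
- by rewrite mulrDr opprD expRD.
Qed.

Lemma sol_mx0 : sol_mx 0 0 0 = 1%:M.
Proof.
apply/matrixP => i j; rewrite !mxE !mulr0 oppr0 expR0.
by case: i => -[|[|[|//]]] i3; case: j => -[|[|[|//]]] j3.
Qed.

Definition sol_elt (a b c : R) : sol_group :=
  exist _ (sol_mx a b c)
    (mem_set (ex_intro _ a (ex_intro _ b (ex_intro _ c erefl)))).

Lemma sol_eltP (g : sol_group) : exists a b c, g = sol_elt a b c.
Proof.
case: g => M MS; have [a [b [c E]]] := set_mem MS.
by exists a, b, c; exact/val_inj.
Qed.

(* The parameters (a, b, c) of [sol_mx a b c], see [sol_coordsE]. *)
Definition sol_coords (g : sol_group) : R * R * R :=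
  (val g 0 1, val g 2 1, ln (val g 0 0) / p%:num).

Lemma sol_coordsE a b c : sol_coords (sol_elt a b c) = (a, b, c).
Proof.
by rewrite /sol_coords !mxE /= expRK mulrAC divff ?mul1r.
Qed.

Lemma sol_mul_subproof (g h : sol_group) : val g *m val h \in sol_set.
Proof.
have [a [b [c ->]]] := sol_eltP g; have [a' [b' [c' ->]]] := sol_eltP h.
by rewrite sol_mxM; exact: valP (sol_elt _ _ _).
Qed.

Definition sol_mul (g h : sol_group) : sol_group :=
  exist _ (val g *m val h) (sol_mul_subproof g h).

Definition sol_one : sol_group := sol_elt 0 0 0.

Lemma sol_inv_mul a b c :
  sol_mx (- (expR (p%:num * - c) * a)) (- (expR (- (q%:num * - c)) * b)) (- c)
    *m sol_mx a b c = 1%:M.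
Proof. by rewrite sol_mxM !addrN addNr sol_mx0. Qed.

Lemma sol_unit (g : sol_group) : val g \in unitmx.
Proof.
have [a [b [c ->]]] := sol_eltP g.
by have [] := mulmx1_unit (sol_inv_mul a b c).
Qed.

Lemma sol_inv_subproof (g : sol_group) : invmx (val g) \in sol_set.
Proof.
have gU := sol_unit g; have [a [b [c E]]] := sol_eltP g; rewrite E /= in gU *.
rewrite -[invmx _]mul1mx -(sol_inv_mul a b c) -mulmxA mulmxV// mulmx1.
exact: valP (sol_elt _ _ _).
Qed.

Definition sol_inv (g : sol_group) : sol_group :=
  exist _ (invmx (val g)) (sol_inv_subproof g).

Lemma sol_mulA : associative sol_mul.
Proof. by move=> g h k; apply/val_inj; rewrite /= mulmxA. Qed.

Lemma sol_mul1 : left_id sol_one sol_mul.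
Proof. by move=> g; apply/val_inj; rewrite /= sol_mx0 mul1mx. Qed.

Lemma sol_mulr1 : right_id sol_one sol_mul.
Proof. by move=> g; apply/val_inj; rewrite /= sol_mx0 mulmx1. Qed.

Lemma sol_mulV : left_inverse sol_one sol_inv sol_mul.
Proof.
by move=> g; apply/val_inj; rewrite /= sol_mx0 mulVmx ?sol_unit.
Qed.

Lemma sol_mulrV : right_inverse sol_one sol_inv sol_mul.
Proof.
by move=> g; apply/val_inj; rewrite /= sol_mx0 mulmxV ?sol_unit.
Qed.

HB.instance Definition _ := isGroup.Build sol_group sol_mulA sol_mul1
  sol_mulr1 sol_mulV sol_mulrV.

Definition sol_space : normedModType R := (R * R * R)%type.

(* The value of ds^2 at the point u on the tangent vector v. *)
Definition sol_ds2 (u v : sol_space) : R :=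
  let: (_, _, z) := u in let: (dx, dy, dz) := v in
  expR (- (2 * p%:num * z)) * dx ^+ 2 + expR (2 * q%:num * z) * dy ^+ 2
    + dz ^+ 2.

(* Differentiability suffices: such maps preserve the Riemannian distance, so
   they are smooth by the Myers-Steenrod theorem. *)
Definition sol_isometry (f : sol_space -> sol_space) : Prop :=
  [/\ (forall u, differentiable f u),
      (exists2 f', cancel f f' /\ cancel f' f & forall u, differentiable f' u)
    & forall u v, sol_ds2 (f u) ('d f u v) = sol_ds2 u v].

Definition sol_act_fun (g : sol_group) (u : sol_space) : sol_space :=
  let: (a, b, c) := sol_coords g in let: (x, y, z) := u in
  (expR (p%:num * c) * x + a, expR (- (q%:num * c)) * y + b, c + z).

Lemma sol_act1 u : sol_act_fun 1%g u = u.
Proof.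
case: u => -[x y] z.
by rewrite /sol_act_fun sol_coordsE !mulr0 oppr0 expR0 !mul1r !addr0 add0r.
Qed.

Lemma sol_actM g h u :
  sol_act_fun (g * h)%g u = sol_act_fun g (sol_act_fun h u).
Proof.
have [a [b [c ->]]] := sol_eltP g; have [a' [b' [c' ->]]] := sol_eltP h.
have -> : (sol_elt a b c * sol_elt a' b' c')%g =
    sol_elt (expR (p%:num * c) * a' + a) (expR (- (q%:num * c)) * b' + b)
      (c + c') by apply/val_inj; exact: sol_mxM.
case: u => -[x y] z; rewrite /sol_act_fun !sol_coordsE.
by rewrite !mulrDr !opprD !expRD !mulrA !addrA.
Qed.

Definition sol_action : group_action sol_group sol_space :=
  GroupAction sol_act1 sol_actM.

Lemma sol_actE a b c x y z : sol_action (sol_elt a b c) (x, y, z) =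
  (expR (p%:num * c) * x + a, expR (- (q%:num * c)) * y + b, c + z).
Proof. by rewrite /= /sol_act_fun sol_coordsE. Qed.
End SolGroup.

(* Main.v *)
Require Import Defs.
From HB Require Import structures.
From mathcomp Require Import all_boot all_order all_algebra.
From mathcomp Require Import all_classical all_reals all_analysis.
From mathcomp Require Import ring lra zify.
Import Order.TTheory GRing.Theory Num.Theory.
Import numFieldNormedType.Exports.
Local Open Scope classical_set_scope.
Local Open Scope ring_scope.

(** Since [\det A = 1] and [\tr A > 2], the eigenvalues of [A] are
    [lambda = e^p] and [lambda^-1 = e^(-p)].  A left eigenvector of [A] for an
    eigenvalue [k] is a linear form [E_k] on Z^2 with
    [E_k (A^m v) = k^m E_k v], so
      [(v, m) |-> (E_lambda v, E_(lambda^-1) v, m)]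
    turns the multiplication of the semidirect product into that of S(p,p)
    ([sol_embeddingM]): [A] is diagonalised over the reals, and the two axes of
    R^2 are scaled by [e^(pm)] and [e^(-pm)].

    The vectors [(E_lambda v, E_(lambda^-1) v)] form a lattice in R^2, because
    the two forms are linearly independent.  Two quantitative versions of this
    carry the proof: nonzero lattice vectors stay away from 0
    ([eig_forms_discrete]) and every point of R^2 is within bounded distance of
    the lattice ([eig_forms_cobounded]).  The first gives injectivity and
    discreteness together: distinct elements of the image have coordinates at
    distance at least some [e > 0] ([sol_embedding_separated]).  The second
    says that every point of Sol(p,p) can be moved by the image into a fixed
    compact box: first bring [z] into [[0, 1]] with the Z factor, then bring
    [(x, y)] near 0 with the lattice, which leaves [z] alone
    ([sol_embedding_cobounded]).

    S(p,q) acts simply transitively on Sol(p,q), and in coordinates the action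
    is left multiplication ([sol_of_coords_act]).  The same box therefore
    proves compactness of the orbit space and, through [x |-> x^-1], which
    exchanges left and right cosets, of the space of left cosets
    ([cocompact_sol]).  That the action is isometric holds for the whole group
    S(p,q): its elements act by diagonal affine maps whose scaling of [dx] and
    [dy] cancels the change of the metric under [z |-> c + z]. *)

Set Implicit Arguments.
Unset Strict Implicit.

(** * Eigenvalues of 2 x 2 matrices *)

Lemma det_mx22 (T : comNzRingType) (M : 'M[T]_2) :
  \det M = M 0 0 * M 1 1 - M 0 1 * M 1 0.
Proof.
rewrite (expand_det_row _ 0) !big_ord_recl big_ord0 addr0 /cofactor.
rewrite !det_mx11 !mxE /= expr0 expr1 mul1r.
have -> : lift 0 0 = 1 :> 'I_2 by exact/val_inj.
have -> : lift 1 0 = 0 :> 'I_2 by exact/val_inj.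
by rewrite mulN1r mulrN.
Qed.

Lemma mxtrace22 (T : pzSemiRingType) (M : 'M[T]_2) : \tr M = M 0 0 + M 1 1.
Proof.
rewrite /mxtrace !big_ord_recl big_ord0 addr0.
by congr (_ + M _ _); exact/val_inj.
Qed.

Lemma eigenvalue_mx22 (F : fieldType) (M : 'M[F]_2) (k : F) :
  eigenvalue M k = (k ^+ 2 - \tr M * k + \det M == 0).
Proof.
rewrite eigenvalue_root_char rootE (@horner_coef_wide _ 3) ?size_char_poly//.
rewrite !big_ord_recl big_ord0 /=.
have -> : (char_poly M)`_(bump 0 (bump 0 0)) = 1.
  by have /monicP := char_poly_monic M; rewrite lead_coefE size_char_poly.
rewrite char_poly_det -[bump 0 0]/(2.-1) char_poly_trace//.
rewrite sqrrN expr1n; congr (_ == 0); rewrite expr0 expr1; ring.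
Qed.

Lemma eigenvalueV_mx22 (F : fieldType) (M : 'M[F]_2) (k : F) :
  \det M = 1 -> k != 0 -> eigenvalue M k -> eigenvalue M k^-1.
Proof.
rewrite !eigenvalue_mx22 => -> k0 /eqP kM; apply/eqP/(mulfI (expf_neq0 2 k0)).
by rewrite mulr0 -{}kM; field.
Qed.

(** A triangular integer matrix of determinant 1 has diagonal entries [1, 1]
    or [-1, -1], hence trace at most 2. *)
Lemma hyperbolic_offdiag (A : 'M[int]_2) :
  \det A = 1 -> 2 < \tr A -> A 1 0 != 0.
Proof.
rewrite det_mx22 mxtrace22 => dA tA; apply/eqP => c0.
move: dA tA; rewrite c0 mulr0 subr0; set a := A 0 0; set d := A 1 1 => ad tad.
by have [a0|a0] := leP a 0; have [d0|d0] := leP d 0; nia.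
Qed.

(** * The eigenforms of an integer matrix *)

(** The row [(A 1 0, k - A 0 0)] is a left eigenvector of [A] for the
    eigenvalue [k]. *)
Definition eig_form (R : realType) (A : 'M[int]_2) (k : R) (v : 'cV[int]_2) :=
  (A 1 0)%:~R * (v 0 0)%:~R + (k - (A 0 0)%:~R) * (v 1 0)%:~R.

Section EigForm.
Variables (R : realType) (A : 'M[int]_2).
Implicit Types (k : R) (v w : 'cV[int]_2).

Lemma eig_formD k v w : eig_form A k (v + w) = eig_form A k v + eig_form A k w.
Proof. by rewrite /eig_form !mxE !rmorphD/=; ring. Qed.

Lemma eig_formN k v : eig_form A k (- v) = - eig_form A k v.
Proof. by rewrite /eig_form !mxE !rmorphN/=; ring. Qed.

Hypothesis detA : \det A = 1.

Lemma eig_form_mulmx k v : eigenvalue (map_mx intr A) k ->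
  eig_form A k (A *m v) = k * eig_form A k v.
Proof.
rewrite eigenvalue_mx22 det_map_mx trace_map_mx detA mxtrace22 /= => /eqP kR.
move: detA; rewrite det_mx22 => /(congr1 (intr : int -> R)).
move: kR; rewrite rmorphB !rmorphM rmorphD /= => kR detR.
rewrite /eig_form !mxE !big_ord_recl !big_ord0 !addr0.
have -> : lift ord0 ord0 = 1 :> 'I_2 by exact/val_inj.
rewrite !rmorphD !rmorphM /=; apply/eqP; rewrite -subr_eq0; apply/eqP.
(* The difference is a combination of the characteristic equation of k and of
   the determinant equation. *)
transitivity (
    - (v 1 0)%:~R *
      (k ^+ 2 - ((A 0 0)%:~R + (A 1 1)%:~R) * k + 1%:~R) +
    (1%:~R - ((A 0 0)%:~R * (A 1 1)%:~R - (A 0 1)%:~R * (A 1 0)%:~R))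
      * (v 1 0)%:~R); first ring.
by rewrite kR detR subrr mulr0 mul0r addr0.
Qed.

Lemma eig_form_expmx k v (m : int) : eigenvalue (map_mx intr A) k ->
  k != 0 -> eig_form A k (A ^ m *m v) = k ^ m * eig_form A k v.
Proof.
move=> kA k0; have uA := semidirect_unit detA.
elim: m => [|n IH|n IH]; first by rewrite !expr0z mul1mx mul1r.
  rewrite -[_ ^ n.+1]/(A ^+ n.+1) exprS -mulmxA eig_form_mulmx// IH.
  by rewrite exprSz mulrA.
apply: (mulfI k0); rewrite -eig_form_mulmx// mulmxA mulrA.
have -> : A *m A ^ (- n.+1%:Z) = A ^ (- n%:Z).
  rewrite -[A in A *m _]expr1z -[_ *m _]/(_ * _) -exprzDr//.
  by congr (A ^ _); lia.
rewrite IH; congr (_ * _).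
by rewrite -[X in X * _]expr1z -expfzDr//; congr (k ^ _); lia.
Qed.

End EigForm.

(** * The lattice of the values of two eigenforms *)

Lemma cV2P (T : Type) (v w : 'cV[T]_2) :
  v 0 0 = w 0 0 -> v 1 0 = w 1 0 -> v = w.
Proof.
move=> e0 e1; apply/matrixP => i j; rewrite (ord1 j).
case: i => -[|[|//]] i2; [move: e0|move: e1];
  by congr (v _ _ = w _ _); exact/val_inj.
Qed.

Lemma lt1_int0 (R : realType) (n : int) : `|n%:~R : R| < 1 -> n = 0.
Proof. by rewrite -intr_norm -[1]/(1%:~R) ltr_int; lia. Qed.

Section Lattice.
Variables (R : realType) (A : 'M[int]_2) (k l : R).
Hypotheses (A10 : A 1 0 != 0) (lk : l < k).
Local Notation E := (eig_form A).
Local Notation a := (A 0 0).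
Local Notation c := (A 1 0).

(** The difference of the two forms is [(k - l) (v 1 0)]: if it is smaller than
    [k - l], the integer [v 1 0] vanishes, and what remains of either form is
    the integer [c (v 0 0)]. *)
Lemma eig_forms_discrete : exists2 e : R, 0 < e &
  forall v, `|E k v| < e -> `|E l v| < e -> v = 0.
Proof.
exists (Num.min ((k - l) / 2) 1) => [|v].
  by rewrite lt_min ltr01 andbT divr_gt0// subr_gt0.
rewrite !lt_min => /andP[vk vk1] /andP[vl _].
have v1 : v 1 0 = 0.
  apply: (@lt1_int0 R).
  rewrite -(ltr_pM2l (_ : 0 < k - l)) ?subr_gt0// mulr1.
  rewrite -[k - l as X in X * `|_|]gtr0_norm ?subr_gt0// -normrM.
  have -> : (k - l) * (v 1 0)%:~R = E k v - E l v by rewrite /eig_form; ring.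
  by apply: le_lt_trans (ler_normB _ _) _; lra.
apply: cV2P; rewrite mxE//.
move: vk1; rewrite /eig_form v1 mulr0 addr0 -rmorphM => /lt1_int0/eqP.
by rewrite mulf_eq0 (negPf A10) => /eqP.
Qed.

Lemma eig_forms_cobounded : exists D : R, forall x y, exists v,
  `|E k v + x| <= D /\ `|E l v + y| <= D.
Proof.
exists (`|c%:~R| + `|k - a%:~R| + `|l - a%:~R|) => x y.
have kl0 : k - l != 0 by rewrite subr_eq0 gt_eqF.
have c0 : (c%:~R : R) != 0 by rewrite intr_eq0.
(* (t0, t1) is the real vector at which the two forms take the values -x and
   -y; rounding it down moves each coordinate by at most 1. *)
pose t1 := - (x - y) / (k - l).
pose t0 := (- x - (k - a%:~R) * t1) / c%:~R.
pose v : 'cV[int]_2 :=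
  \col_i (if i == 0 then Num.floor t0 else Num.floor t1).
have frac (t : R) : `|(Num.floor t)%:~R - t| <= 1.
  rewrite distrC ger0_norm ?subr_ge0 ?floor_le_tmp// lerBlDl.
  by rewrite -[X in _ + X]/(1%:~R) -rmorphD/= ltW// floorD1_gt.
have bound z : `|c%:~R * ((v 0 0)%:~R - t0) + z * ((v 1 0)%:~R - t1)|
    <= `|c%:~R| + `|z|.
  rewrite (le_trans (ler_normD _ _))// !normrM lerD// ler_piMr// !mxE/=;
    exact: frac.
exists v; split.
  have -> : E k v + x =
      c%:~R * ((v 0 0)%:~R - t0) + (k - a%:~R) * ((v 1 0)%:~R - t1).
    by rewrite /eig_form /t0 /t1; field; rewrite ?c0 ?kl0.
  by apply: le_trans (bound _) _; rewrite lerDl.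
have -> : E l v + y =
    c%:~R * ((v 0 0)%:~R - t0) + (l - a%:~R) * ((v 1 0)%:~R - t1).
  by rewrite /eig_form /t0 /t1; field; rewrite ?c0 ?kl0.
by apply: le_trans (bound _) _; rewrite addrAC lerDl.
Qed.

End Lattice.

(** * Continuity *)

Lemma continuous_pair (T U V : topologicalType) (f : T -> U) (g : T -> V) :
  continuous f -> continuous g -> continuous (fun t => (f t, g t)).
Proof. by move=> cf cg t; exact: (cvg_pair (cf t) (cg t)). Qed.

Section RealContinuity.
Variables (R : realType) (T : topologicalType).
Implicit Types f g : T -> R.

Lemma continuous_oppf f : continuous f -> continuous (fun t => - f t).
Proof. by move=> cf t; apply: cvgN; exact: cf. Qed.

Lemma continuous_mulf f g :
  continuous f -> continuous g -> continuous (fun t => f t * g t).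
Proof. by move=> cf cg t; apply: cvgM; [exact: cf|exact: cg]. Qed.

Lemma continuous_cstM (x : R) f : continuous f -> continuous (fun t => x * f t).
Proof. by apply: continuous_mulf => t; exact: cvg_cst. Qed.

Lemma continuous_expRf f : continuous f -> continuous (fun t => expR (f t)).
Proof.
move=> cf t; apply: (@continuous_comp T R R f (@expR R)); first exact: cf.
exact: continuous_expR.
Qed.

End RealContinuity.

Section SolSpaceContinuity.
Variable R : realType.

Lemma sol_space_x_continuous : continuous (fun u : sol_space R => u.1.1).
Proof.
move=> u; apply: (@continuous_comp (R * R * R)%type (R * R)%type R fst fst);
  exact: cvg_fst.
Qed.

Lemma sol_space_y_continuous : continuous (fun u : sol_space R => u.1.2).
Proof.
move=> u; apply: (@continuous_comp (R * R * R)%type (R * R)%type R fst snd).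
  exact: cvg_fst.
exact: cvg_snd.
Qed.

Lemma sol_space_z_continuous : continuous (fun u : sol_space R => u.2).
Proof. by move=> u; exact: cvg_snd. Qed.

End SolSpaceContinuity.

(** The quotient is the continuous image of any compact set that meets all
    classes. *)
Lemma compact_quotient (T X : topologicalType) (Q : quotType X) (f : T -> X)
    (K : set T) : continuous f -> compact K ->
    (forall x, exists2 k, K k & (\pi_Q (f k) = \pi_Q x)%qT) ->
  compact [set: quotient_topology Q].
Proof.
move=> cf cK surj.
rewrite (_ : setT = (\pi_(quotient_topology Q)%qT \o f) @` K).
  apply: continuous_compact => //; apply: continuous_subspaceT => x.
  by apply: continuous_comp; [exact: cf|exact: pi_continuous].
apply/seteqP; split => // y _; have [k Kk fk] := surj (repr y).
exists k => //=; rewrite -[RHS]reprK.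
(* Once Q is a constructor, the projections to Q and to its topological copy
   are convertible. *)
by case: Q y {surj} fk => Q0 c y fk.
Qed.

(** * The group S(p,q) and its action on Sol(p,q) *)

Section SolGroup.
Variables (R : realType) (p q : {posnum R}).
Local Notation S := (sol_group p q).

Lemma sol_eltM a b c a' b' c' : (sol_elt p q a b c * sol_elt p q a' b' c')%g =
  sol_elt p q (expR (p%:num * c) * a' + a) (expR (- (q%:num * c)) * b' + b)
    (c + c').
Proof. by apply/val_inj; exact: sol_mxM. Qed.

(** The orbit map at the origin of the simply transitive action identifies
    S(p,q) with Sol(p,q); this is its inverse. *)
Definition sol_of_coords (u : sol_space R) : S := sol_elt p q u.1.1 u.1.2 u.2.

Lemma sol_of_coordsK (g : S) : sol_of_coords (sol_coords g) = g.
Proof. by have [a [b [c ->]]] := sol_eltP g; rewrite sol_coordsE. Qed.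

Lemma sol_of_coords_act (g : S) u :
  sol_of_coords (sol_action p q g u) = (g * sol_of_coords u)%g.
Proof.
have [a [b [c ->]]] := sol_eltP g; case: u => -[x y] z.
by rewrite sol_actE /sol_of_coords sol_eltM.
Qed.

Lemma sol_coords_continuous : continuous (@sol_coords R p q : S -> sol_space R).
Proof.
have entry i j : continuous (fun g : S => val g i j).
  move=> g; apply: (@continuous_comp S 'M[R]_3 R val (fun M => M i j)).
    exact: initial_continuous.
  exact: coord_continuous.
apply: (@continuous_pair S (R * R)%type R (fun g => (val g 0 1, val g 2 1))
  (fun g => ln (val g 0 0) / p%:num)).
  by apply: (@continuous_pair S R R); exact: entry.
move=> g; apply: (@cvgMr_tmp R S (nbhs g) _ (fun g : S => ln (val g 0 0))).
apply: (@continuous_comp S R R (fun g => val g 0 0) (@ln R)).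
  exact: entry.
apply: continuous_ln; have [a [b [c ->]]] := sol_eltP g.
by rewrite !mxE /= expR_gt0.
Qed.

Lemma sol_elt_continuous (T : topologicalType) (a b c : T -> R) :
  continuous a -> continuous b -> continuous c ->
  continuous (fun t => sol_elt p q (a t) (b t) (c t)).
Proof.
move=> ca cb cc; apply: continuous_comp_initial => t P [B nB sBP].
have entry i j : continuous (fun t => sol_mx p q (a t) (b t) (c t) i j).
  have cst (x : R) : continuous (fun _ : T => x) by move=> s; exact: cvg_cst.
  rewrite /sol_mx; under eq_fun do rewrite mxE.
  case: i => -[|[|[|//]]] i3; case: j => -[|[|[|//]]] j3 /=.
  - by apply: continuous_expRf; exact: continuous_cstM.
  - exact: ca.
  - exact: cst.
  - exact: cst.
  - exact: cst.
  - exact: cst.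
  - exact: cst.
  - exact: cb.
  - by apply/continuous_expRf/continuous_oppf; exact: continuous_cstM.
have : \forall s \near t, forall ij : 'I_3 * 'I_3,
    B ij.1 ij.2 (sol_mx p q (a s) (b s) (c s) ij.1 ij.2).
  by apply: filter_forall => -[i j]; exact: (entry i j t _ (nB i j)).
by apply: filterS => s Bs; apply: sBP => i j; exact: (Bs (i, j)).
Qed.

Lemma sol_of_coordsV_continuous : continuous (fun u => (sol_of_coords u)^-1%g).
Proof.
have cx := @sol_space_x_continuous R; have cy := @sol_space_y_continuous R.
have cz := continuous_oppf (@sol_space_z_continuous R).
rewrite (_ : (fun _ => _) = (fun u =>
  sol_elt p q (- (expR (p%:num * - u.2) * u.1.1))
    (- (expR (- (q%:num * - u.2)) * u.1.2)) (- u.2))); last first.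
  apply/funext => u; apply: (@mulIg _ (sol_of_coords u)).
  by rewrite mulVg sol_eltM !addrN addNr.
apply: sol_elt_continuous; last exact: cz.
  apply/continuous_oppf/(continuous_mulf _ cx)/continuous_expRf.
  exact: continuous_cstM.
apply/continuous_oppf/(continuous_mulf _ cy)/continuous_expRf.
exact/continuous_oppf/continuous_cstM.
Qed.

Lemma is_diff_diag_affine (al be a b c : R) (u : sol_space R) :
  is_diff u
    (fun v : sol_space R =>
      (al * v.1.1 + a, be * v.1.2 + b, c + v.2) : sol_space R)
    (fun v : sol_space R => (al * v.1.1, be * v.1.2, v.2) : sol_space R).
Proof.
pose L (v : sol_space R) : sol_space R := (al * v.1.1, be * v.1.2, v.2).
have Llin : linear L.
  move=> k [[x y] z] [[x' y'] z']; rewrite /L /=.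
  by congr (_, _, _) => /=; rewrite mulrDr mulrCA.
pose LM := GRing.isLinear.Build _ _ _ _ _ Llin.
pose LL : {linear _ -> _} := HB.pack L LM.
have Lcont : continuous LL.
  apply: (@continuous_pair _ (R * R)%type R
    (fun v : sol_space R => (al * v.1.1, be * v.1.2)) (fun v => v.2)).
    apply: (@continuous_pair _ R R).
      by apply: continuous_cstM; exact: sol_space_x_continuous.
    by apply: continuous_cstM; exact: sol_space_y_continuous.
  exact: sol_space_z_continuous.
have -> : (fun v => (al * v.1.1 + a, be * v.1.2 + b, c + v.2) : sol_space R) =
    (LL : sol_space R -> sol_space R) + cst ((a, b, c) : sol_space R).
  apply/funext => v; rewrite [RHS]/GRing.add /=.
  by congr (_, _, _); rewrite addrC.
have dL : is_diff u LL LL.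
  by apply: DiffDef; [exact: linear_differentiable|rewrite diff_lin].
apply: is_diff_eq.
by rewrite addr0.
Qed.

(** An element with third coordinate [c] multiplies [dx^2] by [e^(2pc)] and
    [dy^2] by [e^(-2qc)], which compensates the metric coefficients
    [e^(-2p(c + z))] and [e^(2q(c + z))] at the image point. *)
Lemma sol_action_isometry (g : S) : sol_isometry p q (sol_action p q g).
Proof.
have dif (h : S) u : exists2 f', is_diff u (sol_action p q h) f' &
    forall v, sol_ds2 p q (sol_action p q h u) (f' v) = sol_ds2 p q u v.
  have [a [b [c ->]]] := sol_eltP h.
  set f := (X in is_diff_def _ X).
  have -> : f = (fun v =>
      (expR (p%:num * c) * v.1.1 + a, expR (- (q%:num * c)) * v.1.2 + b,
       c + v.2)).
    by apply/funext => -[[x y] z]; rewrite /f sol_actE.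
  eexists; first exact: is_diff_diag_affine.
  move=> [[dx dy] dz]; case: u => -[x y] z; rewrite sol_actE /=.
  rewrite !exprMn !mulrA -!expRD.
  by congr (expR _ * _ * _ + expR _ * _ * _ + _); ring.
split=> [u||u v].
- by have [f' df _] := dif g u; exact: ex_diff.
- exists (sol_action p q g^-1%g); first split=> u.
  + by rewrite -actM mulVg act1.
  + by rewrite -actM mulgV act1.
  + by move=> u; have [f' df _] := dif g^-1%g u; exact: ex_diff.
- by have [f' df <-] := dif g u; rewrite diff_val.
Qed.

(** Moving the coordinates of [x^-1] into [K] by [phi g] means that
    [phi g * x^-1] lies over [K]; inverting it gives a representative
    [x * phi g^-1] of the left coset of [x]. *)
Lemma cocompact_sol (G : groupType) (phi : UMagmaMorphism.type G S)
    (K : set (sol_space R)) :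
  compact K -> (forall u, exists g, K (sol_action p q (phi g) u)) ->
  compact [set: quotient_topology (lcosets_quot (image_group phi))] /\
  compact [set: quotient_topology
    (orbit_quot (restrict_action (sol_action p q) phi))].
Proof.
move=> cK KG; split.
  apply: (@compact_quotient _ S _ (fun u => (sol_of_coords u)^-1%g) K) => //.
    exact: sol_of_coordsV_continuous.
  move=> x; have [g Kg] := KG (sol_coords x^-1%g).
  exists (sol_action p q (phi g) (sol_coords x^-1%g)) => //.
  apply/eqmodP/asboolP.
  rewrite /lcoset_rel invgK sol_of_coords_act sol_of_coordsK mulgVK.
  by apply/asboolP; exists g.
apply: (@compact_quotient _ (sol_space R) _ id K).
- by move=> ?; exact: cvg_id.
- exact: cK.
move=> u; have [g Kg] := KG u; exists (sol_action p q (phi g) u) => //.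
apply/eqmodP/asboolP; exists g^-1%g.
by rewrite -[RHS](act1 (restrict_action (sol_action p q) phi)) -(mulVg g) actM.
Qed.

End SolGroup.

(** * The embedding of the semidirect product *)

Lemma expRM_intr (R : realType) (x : R) (m : int) :
  expR (x * m%:~R) = expR x ^ m.
Proof.
case: m => n; first exact: expRM_natr.
by rewrite NegzE mulrNz mulrN expRN expRM_natr exprnN.
Qed.

Section Embedding.
Variables (R : realType) (A : 'M[int]_2) (detA : \det A = 1) (p : {posnum R}).

Local Notation Eu := (eig_form A (expR p%:num)).
Local Notation Es := (eig_form A (expR (- p%:num))).

Definition sol_embedding (g : semidirect detA) : sol_group p p :=
  sol_elt p p (Eu g.1) (Es g.1) g.2%:~R.

Lemma sol_embedding1 : sol_embedding 1%g = 1%g.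
Proof. by rewrite /sol_embedding /= /eig_form !mxE !mulr0 !addr0. Qed.

Lemma sol_embeddingM : eigenvalue (map_mx intr A : 'M[R]_2) (expR p%:num) ->
  {morph sol_embedding : g h / (g * h)%g}.
Proof.
move=> pA [v m] [w n]; rewrite /sol_embedding sol_eltM -mulNr !expRM_intr.
have NpA : eigenvalue (map_mx intr A : 'M[R]_2) (expR (- p%:num)).
  rewrite expRN; apply: eigenvalueV_mx22; rewrite ?expR_eq0//.
  by rewrite det_map_mx detA.
congr (sol_elt _ _ _ _ _).
- by rewrite eig_formD eig_form_expmx// expR_eq0.
- by rewrite eig_formD eig_form_expmx// expR_eq0.
- exact: rmorphD.
Qed.

Hypothesis trA : 2 < \tr A.

Let ltN_expR : expR (- p%:num) < expR p%:num.
Proof. by rewrite ltr_expR gtrN. Qed.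

Lemma sol_embedding_separated : exists2 e : R, 0 < e & forall g h,
  ball (sol_coords (sol_embedding g)) e (sol_coords (sol_embedding h)) -> g = h.
Proof.
have [e e0 eP] := eig_forms_discrete (hyperbolic_offdiag detA trA) ltN_expR.
(* The bound 1 separates distinct third coordinates, which are integers. *)
exists (Num.min e 1) => [|[v m] [w n]]; first by rewrite lt_min e0 ltr01.
rewrite !sol_coordsE => -[[]]; rewrite /= -!(@ball_normE R R) /=.
rewrite -!eig_formN -!eig_formD -rmorphB /= !lt_min.
move=> /andP[v1 _] /andP[v2 _] /andP[_ /lt1_int0 mn].
by congr pair; apply/eqP; rewrite -subr_eq0; apply/eqP => //; exact: eP.
Qed.

Lemma sol_embedding_inj : injective sol_embedding.
Proof.
have [e e0 eP] := sol_embedding_separated.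
by move=> g h gh; apply: eP; rewrite gh; exact: ballxx.
Qed.

Lemma sol_embedding_discrete : discrete_subset (range sol_embedding).
Proof.
have [e e0 eP] := sol_embedding_separated.
apply/seteqP; split; first exact: isolatedS.
move=> _ [g _ <-]; split; first by apply/mem_set; exists g.
exists (@sol_coords R p p @^-1`
    ball (sol_coords (sol_embedding g) : sol_space R) e).
  exact/sol_coords_continuous/nbhsx_ballx.
apply/seteqP; split=> [t [gt [h _ ht]]|_ -> /=].
  by move: gt; rewrite -ht /= => /eP ->.
by split; [exact: ballxx|exists g].
Qed.

Definition sol_box (D : R) : set (sol_space R) :=
  `[- D, D] `*` `[- D, D] `*` `[0, 1].

Lemma sol_box_compact D : compact (sol_box D).
Proof. by do ?[apply: compact_setX]; exact: segment_compact. Qed.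

Lemma sol_embedding_cobounded : exists D : R, forall u, exists g,
  sol_box D (sol_action p p (sol_embedding g) u).
Proof.
have [D DP] := eig_forms_cobounded (hyperbolic_offdiag detA trA) ltN_expR.
exists D => -[[x y] z]; pose m : int := - Num.floor z.
(* (v, m) translates by the lattice vector of v after scaling by e^(pm) and
   e^(-pm), so v is chosen for the scaled point. *)
have [v [v1 v2]] :=
  DP (expR (p%:num * m%:~R) * x) (expR (- (p%:num * m%:~R)) * y).
exists (v, m); rewrite sol_actE /sol_box /= !in_itv /= -!ler_norml.
rewrite ![_ * x + _]addrC ![_ * y + _]addrC v1 v2; split=> //.
rewrite /m rmorphN /= addrC subr_ge0 floor_le_tmp// lerBlDl.
by rewrite -[X in _ + X]/(1%:~R) -rmorphD/= ltW// floorD1_gt.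
Qed.

End Embedding.

Theorem proposition3p4 (R : realType) (A : 'M[int]_2) (detA : \det A = 1)
    (trA : 2 < \tr A) (lambda : R)
    (lambda_eig : eigenvalue (map_mx intr A) lambda) (lambda_gt1 : 1 < lambda)
    (p : {posnum R}) (p_log : p%:num = ln lambda) :
  exists phi : UMagmaMorphism.type (semidirect detA) (sol_group p p),
    [/\ injective phi,
        discrete_subset [set` image_group phi],
        compact [set: quotient_topology (lcosets_quot (image_group phi))],
        forall g, sol_isometry p p (restrict_action (sol_action p p) phi g) &
        compact [set: quotient_topology
          (orbit_quot (restrict_action (sol_action p p) phi))]].
Proof.
have pA : eigenvalue (map_mx intr A) (expR p%:num).
  by rewrite p_log lnK// posrE (lt_trans ltr01).
pose phi : UMagmaMorphism.type (semidirect detA) (sol_group p p) :=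
  HB.pack (@sol_embedding R A detA p)
    (isUMagmaMorphism.Build _ _ _
      (sol_embedding1 detA p, @sol_embeddingM R A detA p pA)).
have [D DP] := sol_embedding_cobounded detA p trA.
have [cL cO] := @cocompact_sol R p p _ phi _ (sol_box_compact (D := D)) DP.
exists phi; split => //.
- exact: sol_embedding_inj.
- rewrite (_ : [set` _] = range phi); first exact: sol_embedding_discrete.
  by apply/seteqP; split=> x /asboolP.
- by move=> g; exact: sol_action_isometry.
Qed.
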